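(* Let $A$ be a finite alphabet with at least two letters and let $\le$ be a cylinder order on $A^\infty$. Then $p_{\mathbf{m}_\le}(n)\le 3n-2$ for all $n\ge2$.
   Context: $A^\infty$ is the set of one-sided infinite words over $A$, with the ultrametric $d(a_1a_2\cdots,b_1b_2\cdots)=2^{-\min\{n\ge1 : a_n\ne b_n\}}$ for distinct words (and $d(\mathbf{a},\mathbf{a})=0$). A cylinder order on $A^\infty$ is a total order $\le$ such that $\mathbf{a}\le\mathbf{b}\le\mathbf{c}$ implies $d(\mathbf{a},\mathbf{b})\le d(\mathbf{a},\mathbf{c})$. For such an order, $s_\le(a_1a_2\cdots)=\sup_{n\ge1}a_na_{n+1}\cdots$ (supremum w.r.t. $\le$), $\mathcal{M}_\le=\{s_\le(\mathbf{a}):\mathbf{a}\in A^\infty\}$, and $\mathbf{m}_\le$ denotes the smallest (w.r.t. $\le$) accumulation point (w.r.t. $d$) of $\mathcal{M}_\le$. The factor complexity of an infinite word $a_1a_2\cdots$ is $p_{a_1a_2\cdots}(n)=\#\{a_{k+1}a_{k+2}\cdots a_{k+n} : k\ge0\}$. *)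

(* Defs.v *)
From HB Require Import structures.
From mathcomp Require Import all_boot all_order all_algebra.
From mathcomp Require Import boolp classical_sets functions cardinality.
From mathcomp Require Import reals Rstruct.
From Stdlib Require Rdefinitions.

Set Implicit Arguments.
Unset Strict Implicit.
Unset Printing Implicit Defensive.

Import Order.TTheory GRing.Theory Num.Theory.
Local Open Scope classical_set_scope.
Local Open Scope ring_scope.
Local Notation R := Rdefinitions.R.

(* Infinite words are functions nat -> A indexed from 0: the letter a_n of the
   word a_1 a_2 ... is [a n.-1]. *)

Section Words.
Variable A : finType.
Implicit Types (a b c x y z : nat -> A) (S M : set (nat -> A)).

(* The first difference is 0-based, hence the successor in the exponent. *)
Definition dist a b : R :=
  if pselect (exists k, a k != b k) is left h then 2%:R ^- (ex_minn h).+1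
  else 0.

Record cylinder_order (le : rel (nat -> A)) : Prop := CylinderOrder {
  cyl_refl : reflexive le;
  cyl_anti : antisymmetric le;
  cyl_trans : transitive le;
  cyl_total : total le;
  cyl_dist : forall a b c, le a b -> le b c -> dist a b <= dist a c }.

Definition is_sup (le : rel (nat -> A)) S x : Prop :=
  (forall y, S y -> le y x) /\
  (forall z, (forall y, S y -> le y z) -> le x z).

Definition shift k a : nat -> A := fun i => a (k + i)%N.

Definition suffixes a : set (nat -> A) := [set shift k a | k in [set: nat]].

(* The default value [a] is never used for a cylinder order, see
   [sup_suffixesP]. *)
Definition sup_suffixes (le : rel (nat -> A)) a : nat -> A :=
  xget a (is_sup le (suffixes a)).

Definition sup_words (le : rel (nat -> A)) : set (nat -> A) :=
  range (sup_suffixes le).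

Definition accumulation_point M x : Prop :=
  forall e : R, 0 < e -> exists y, [/\ M y, y <> x & dist x y < e].

(* There is exactly one such word for a cylinder order on at least two letters,
   see [smallest_accumulation_point_exists] and
   [smallest_accumulation_point_unique]. *)
Definition smallest_accumulation_point (le : rel (nat -> A)) x : Prop :=
  accumulation_point (sup_words le) x /\
  (forall y, accumulation_point (sup_words le) y -> le x y).

Definition factor_complexity a (n : nat) : nat :=
  #|[pred w : n.-tuple A |
      `[< exists k : nat, w = [tuple a (k + i)%N | i < n] >]]|.

Lemma smallest_accumulation_point_unique le x y : cylinder_order le ->
  smallest_accumulation_point le x -> smallest_accumulation_point le y ->
  x = y.
Proof.
move=> le_cyl [ax mx] [ay my]; apply: (cyl_anti le_cyl).
by rewrite mx // my.
Qed.

Definition agree n a b := forall k, (k < n)%N -> a k = b k.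

Lemma agree_sym n a b : agree n a b -> agree n b a.
Proof. by move=> h k kn; rewrite h. Qed.

Lemma agree_trans n a b c : agree n a b -> agree n b c -> agree n a c.
Proof. by move=> h h' k kn; rewrite h // h'. Qed.

Lemma agree_le m n a b : (m <= n)%N -> agree n a b -> agree m a b.
Proof. by move=> mn h k km; rewrite h // (leq_trans km). Qed.

Lemma agree_eq a b : (forall n, agree n a b) -> a = b.
Proof. by move=> h; apply/funext => k; apply: (h k.+1). Qed.

Lemma agreeP n a b : agree n a b <-> dist a b <= 2%:R ^- n.+1.
Proof.
rewrite /dist; case: pselect => [h|h]; last first.
  split=> _; first by rewrite invr_ge0 exprn_ge0.
  by move=> k _; apply/eqP/negPn/negP => ab; apply: h; exists k.
case: ex_minnP => m abm mmin.
rewrite lef_pV2 ?posrE ?exprn_gt0 // ler_eXn2l ?ltr1n // ltnS.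
split=> [abn|nm k kn].
  by rewrite leqNgt; apply/negP => mn; rewrite abn ?eqxx in abm.
apply/eqP/negPn/negP => /mmin mk.
by have := leq_ltn_trans (leq_trans nm mk) kn; rewrite ltnn.
Qed.

Lemma accumulation_pointP M x : accumulation_point M x <->
  forall n, exists y, [/\ M y, y <> x & agree n x y].
Proof.
split=> [acc n|acc e e0].
  have [|y [My yx xy]] := acc (2%:R ^- n.+1).
    by rewrite invr_gt0 exprn_gt0.
  by exists y; split => //; apply/agreeP/ltW.
pose n := Num.Def.truncn e^-1.
have [y [My yx /agreeP xy]] := acc n.
exists y; split => //; apply: le_lt_trans xy _.
rewrite invf_plt ?posrE ?exprn_gt0 //.
apply: lt_le_trans (truncnS_gt _) _.
by rewrite -natrX ler_nat ltnW // ltn_expl.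
Qed.

Section Order.
Variable le : rel (nat -> A).
Hypothesis le_anti : antisymmetric le.
Hypothesis le_trans : transitive le.
Hypothesis le_total : total le.
Hypothesis le_agree : forall n a b c,
  le a b -> le b c -> agree n a c -> agree n a b.

Lemma le_agree_r n a b c : le a b -> le b c -> agree n a c -> agree n b c.
Proof.
by move=> ab bc ac; apply: agree_trans (agree_sym (le_agree ab bc ac)) ac.
Qed.

Lemma ex_max_agree S n : S !=set0 ->
  exists y, S y /\ forall z, S z -> le z y \/ agree n z y.
Proof.
pose pre a := [tuple a i | i < n].
have preP a b : pre a = pre b -> agree n a b.
  move=> e k kn; have := congr1 (fun t => tnth t (Ordinal kn)) e.
  by rewrite !tnth_mktuple.
have H (l : seq (n.-tuple A)) : (forall z, S z -> pre z \notin l) \/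
    exists y, S y /\ forall z, S z -> pre z \in l -> le z y \/ agree n z y.
  elim: l => [|t l IH]; first by left.
  have [[y [Sy yt]]|Nt] := pselect (exists y, S y /\ pre y = t); last first.
    have notin z : S z -> pre z \in t :: l -> pre z \in l.
      move=> Sz; rewrite inE => /orP[/eqP zt|//].
      by case: Nt; exists z.
    case: IH => [IH|[x [Sx xmax]]].
      by left=> z Sz; apply/negP => /(notin _ Sz); apply/negP/IH.
    by right; exists x; split=> // z Sz /(notin _ Sz); apply: xmax.
  right; case: IH => [IH|[x [Sx xmax]]].
    exists y; split=> // z Sz; rewrite inE => /orP[/eqP zt|zl].
      by right; apply: preP; rewrite zt.
    by have := IH _ Sz; rewrite zl.
  have [xy|yx] := orP (le_total x y).
    exists y; split=> // z Sz; rewrite inE => /orP[/eqP zt|zl].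
      by right; apply: preP; rewrite zt.
    case: (xmax _ Sz zl) => [zx|zx]; first by left; apply: le_trans zx xy.
    have [|yz] := orP (le_total z y); first by left.
    by right; apply/agree_sym/(le_agree_r xy yz)/agree_sym.
  exists x; split=> // z Sz; rewrite inE => /orP[/eqP zt|zl]; last exact: xmax.
  have zy : agree n z y by apply: preP; rewrite zt.
  have [|xz] := orP (le_total z x); first by left.
  by right; apply/agree_sym/(le_agree_r yx xz)/agree_sym.
case=> y0 Sy0; have [N|[y [Sy ymax]]] := H (enum {: n.-tuple A}).
  by have := N _ Sy0; rewrite mem_enum.
by exists y; split=> // z Sz; apply: ymax; rewrite ?mem_enum.
Qed.

Lemma ex_sup S : S !=set0 -> exists x, is_sup le S x /\
  forall n, exists y, S y /\ agree n x y.
Proof.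
move=> S0.
have [y_ yP] := choice (fun n => ex_max_agree n S0).
have Sy n : S (y_ n) by case: (yP n).
have ymax n z : S z -> le z (y_ n) \/ agree n z (y_ n) by case: (yP n) => _; apply.
have yy m n : (n <= m)%N -> agree n (y_ m) (y_ n).
  move=> nm; have [mn|//] := ymax n _ (Sy m).
  have [nm'|] := ymax m _ (Sy n); last by move/(agree_le nm)/agree_sym.
  by have -> : y_ m = y_ n by apply: le_anti; rewrite mn.
pose x k := y_ k.+1 k.
have xy n : agree n x (y_ n) by move=> k kn; rewrite (yy n k.+1).
exists x; split; last by move=> n; exists (y_ n).
split=> [z Sz|u ub].
  have [//|xz] := orP (le_total z x).
  suff -> : x = z by case/orP: (le_total z z).
  apply: agree_eq => n; have [zy|zy] := ymax n _ Sz.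
    exact: le_agree xz zy (xy n).
  by apply: agree_trans (xy n) (agree_sym zy).
have [//|ux] := orP (le_total x u).
suff -> : u = x by case/orP: (le_total x x).
by apply: agree_eq => n; apply: (le_agree_r (ub _ (Sy n)) ux); apply/agree_sym.
Qed.

End Order.

Lemma cyl_agree le n a b c : cylinder_order le ->
  le a b -> le b c -> agree n a c -> agree n a b.
Proof.
move=> le_cyl ab bc /agreeP ac; apply/agreeP.
exact: Order.POrderTheory.le_trans (cyl_dist le_cyl ab bc) ac.
Qed.

Lemma ex_sup_suffixes le a : cylinder_order le ->
  exists x, is_sup le (suffixes a) x /\ forall n, exists k, agree n x (shift k a).
Proof.
move=> lC; have [|x [xs xc]] := ex_sup (cyl_anti lC) (cyl_trans lC)
    (cyl_total lC) (fun n a b c => @cyl_agree le n a b c lC) (S := suffixes a).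
  by exists (shift 0 a); exists 0%N.
by exists x; split=> // n; have [y [[k _ <-] xy]] := xc n; exists k.
Qed.

Lemma sup_suffixesP le a : cylinder_order le ->
  is_sup le (suffixes a) (sup_suffixes le a).
Proof.
move=> lC; apply: xgetPex; have [x [xs _]] := ex_sup_suffixes a lC.
by exists x.
Qed.

Lemma sup_suffixes_agree le a n : cylinder_order le ->
  exists k, agree n (sup_suffixes le a) (shift k a).
Proof.
move=> lC; have [x [xs xc]] := ex_sup_suffixes a lC.
have [su sl] := sup_suffixesP a lC.
suff -> : sup_suffixes le a = x by [].
by apply: (cyl_anti lC); rewrite sl ?xs.2 //; exact: xs.1.
Qed.

Lemma infinite_sup_words le : (1 < #|A|)%N -> cylinder_order le ->
  infinite_set (sup_words le).
Proof.
move=> /card_gt1P[c0 [c1 [_ _ c01]]] lC.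
pose w p k := if (p.+1 %| k)%N then c1 else c0.
have wE p k : (w p k == c1) = (p.+1 %| k)%N.
  by rewrite /w; case: ifP => _; rewrite ?eqxx // (negbTE c01).
have lt_inj p q : (p < q)%N -> sup_suffixes le (w p) <> sup_suffixes le (w q).
  move=> pq e.
  have [i hi] := sup_suffixes_agree (w p) (3 * q.+1) lC.
  have [j hj] := sup_suffixes_agree (w q) (3 * q.+1) lC.
  have ij k : (k < 3 * q.+1)%N -> (p.+1 %| i + k)%N = (q.+1 %| j + k)%N.
    by move=> kn; rewrite -!wE -/(shift i _ k) -/(shift j _ k) -hi // -hj // e.
  pose k := (q.+1 - j %% q.+1)%N.
  have kq : (k <= q.+1)%N by rewrite leq_subr.
  have jk : (q.+1 %| j + k)%N.
    rewrite {1}(divn_eq j q.+1) -addnA subnKC ?dvdn_add ?dvdn_mull //.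
    by rewrite ltnW // ltn_pmod.
  have k1 : (k < 3 * q.+1)%N by rewrite (leq_ltn_trans kq) // ltn_Pmull.
  have k2 : (k + p.+1 < 3 * q.+1)%N.
    apply: (@leq_ltn_trans (2 * q.+1)%N); last by rewrite ltn_pmul2r.
    by rewrite mul2n -addnn leq_add // ltnW.
  have := ij _ k2; rewrite !addnA dvdn_addl // ij // jk dvdn_addr // => /esym.
  by move/dvdn_leq => /(_ isT); rewrite leqNgt ltnS pq.
have inj : injective (fun p => sup_suffixes le (w p)).
  by move=> p q e; case: (ltngtP p q) => // /lt_inj; rewrite e.
move=> fin; apply: infinite_nat.
have : finite_set (range (fun p => sup_suffixes le (w p))).
  by apply: sub_finite_set fin => _ [p _ <-]; exists (w p).
by rewrite (eq_finite_set (inj_card_eq _)) // => p q _ _; apply: inj.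
Qed.

Lemma ex_accumulation_point M : infinite_set M ->
  exists x, accumulation_point M x.
Proof.
move=> infM; have [a0 _] : M !=set0 by apply: infinite_setN0.
pose E (p : seq A) := [set y | M y /\
  forall k, (k < size p)%N -> y k = nth (a0 0%N) p k].
have step p : exists l : A, infinite_set (E p) -> infinite_set (E (rcons p l)).
  apply: contrapT => /forallNP N.
  have fin l : finite_set (E (rcons p l)).
    by apply: contrapT => h; apply: (N l).
  apply: (N (a0 0%N)) => infE; exfalso; apply: infE.
  apply: (@sub_finite_set _ _ (\bigcup_(l in [set: A]) E (rcons p l))).
    move=> y [My yp]; exists (y (size p)) => //; split=> // k.
    rewrite size_rcons ltnS leq_eqVlt nth_rcons => /orP[/eqP ->|kp].
      by rewrite ltnn eqxx.
    by rewrite kp yp.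
  by apply: bigcup_finite => //; apply: finite_finset.
have [f fP] := choice step.
pose p_ n := iter n (fun p => rcons p (f p)) [::].
have psize n : size (p_ n) = n by elim: n => //= n IH; rewrite size_rcons IH.
pose x k := f (p_ k).
have pE n k : (k < n)%N -> nth (a0 0%N) (p_ n) k = x k.
  elim: n => // n IH; rewrite ltnS leq_eqVlt /= nth_rcons psize.
  by move=> /orP[/eqP ->|kn]; rewrite ?ltnn ?eqxx // kn IH.
have infE n : infinite_set (E (p_ n)).
  elim: n => [|n IH]; last exact: fP.
  by apply: contra_not infM; apply: sub_finite_set => y My; split.
exists x; apply/accumulation_pointP => n; apply: contrapT => N.
apply: (infE n); apply: (@sub_finite_set _ _ [set x]) => // y [My yp] /=.
apply: contrapT => yx; apply: N; exists y; split=> // k kn.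
by rewrite yp ?psize // pE.
Qed.

Lemma smallest_accumulation_point_exists le : (1 < #|A|)%N ->
  cylinder_order le -> exists x, smallest_accumulation_point le x.
Proof.
move=> A2 lC; pose Acc := accumulation_point (sup_words le).
pose ge : rel (nat -> A) := fun a b => le b a.
have ge_anti : antisymmetric ge.
  by move=> a b /andP[ba ab]; apply: (cyl_anti lC); apply/andP.
have ge_trans : transitive ge by move=> b a c ba cb; apply: (cyl_trans lC) cb ba.
have ge_total : total ge by move=> a b; apply: (cyl_total lC).
have ge_agree n a b c : ge a b -> ge b c -> agree n a c -> agree n a b.
  move=> ba cb /agree_sym ca; apply: agree_trans (agree_sym ca) _.
  exact: (cyl_agree lC cb ba ca).
have [x0 Ax0] := ex_accumulation_point (infinite_sup_words A2 lC).
have [|x [[xl _] xc]] := ex_sup ge_anti ge_trans ge_total ge_agree (S := Acc).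
  by exists x0.
exists x; split=> //; apply/accumulation_pointP => n.
have [y [/accumulation_pointP Ay xy]] := xc n.
have [yx|yx] := pselect (y = x); first by rewrite -yx; apply: Ay.
have [m ym] : exists m, y m <> x m.
  by apply/existsNP => e; apply: yx; apply/funext.
have [z [Mz _ yz]] := Ay (maxn n m.+1); exists z; split=> //.
  by move=> zx; apply: ym; rewrite -zx; apply: yz; rewrite leq_max ltnSn orbT.
by apply: agree_trans xy _; apply: agree_le yz; apply: leq_maxl.
Qed.

End Words.

(* Main.v *)
Require Import Defs.
From mathcomp Require Import all_boot.
From mathcomp Require Import all_order all_algebra boolp reals Rstruct zify.

Set Implicit Arguments.
Unset Strict Implicit.
Unset Printing Implicit Defensive.

(** Words of the spectrum are those that dominate all their suffixes. Hence the
    ones starting with one of the two smallest letters, written 0 < 1, use no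
    other letter, and the smallest accumulation point [m] is a word over these
    two letters ([binary_reduction]), starting with 1 ([acc_starts_with_one]).

    A word starting with 1 is a sequence of blocks [10^i]. Call [i] low when
    words starting with [10^i1] are smaller than those starting with
    [10^(i+1)]. If at most one length is low, then [m = 10^oo]. Otherwise let
    [j < k] be the two smallest low lengths. Blocks [10^j] and [10^k] lead to
    smaller words than all other ones, so [m = sigma m'], where [sigma] is the
    substitution [0 -> 10^j, 1 -> 10^k] and [m'] is the smallest accumulation
    point for the order pulled back by [sigma], which is again a cylinder order
    ([renormalize]). Iterating, [m] is directed by a sequence of such
    substitutions.

    The growth [p(n+1) - p(n)] is the number of right special words of length
    [n]. Right special words of [sigma m'] are words [0^l] with [l < k], or
    suffixes of [0^j sigma(v) 10^j] with [v] right special in [m']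
    ([special_subst]). Read from right to left they form a tree with one long
    stem, to which each substitution adds a single finite side branch. The side
    branch of a level ends before that of the second next level leaves the stem,
    so that at most three right special words have a given length
    ([special_tree_le3]). With [p(2) <= 4] this gives [p(n) <= 3n - 2]. *)

(** * Cylinder orders and shift-maximal words *)

Section CylinderOrders.
Variable A : finType.
Implicit Types (a b c x y : nat -> A) (le : rel (nat -> A)).

Lemma agree_refl n a : agree n a a.
Proof. by []. Qed.

Lemma first_diff a b : a <> b -> exists n, agree n a b /\ a n != b n.
Proof.
move=> ab; have h : exists n, a n != b n.
  apply: contrapT => N; apply: ab; apply: funext => n.
  by apply/eqP/negPn/negP => abn; apply: N; exists n.
case: (ex_minnP h) => n abn nmin; exists n; split=> // k kn.
by apply/eqP/negPn/negP => /nmin; rewrite leqNgt kn.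
Qed.

Lemma first_diff_uniq p q a b :
  agree p a b -> a p != b p -> agree q a b -> a q != b q -> p = q.
Proof.
move=> abp dp abq dq; case: (ltngtP p q) => // h.
  by rewrite abq ?eqxx in dp.
by rewrite abp ?eqxx in dq.
Qed.

Lemma agree_dist a b c :
  (forall n, agree n a c -> agree n a b) -> (dist a b <= dist a c)%R.
Proof.
move=> h; rewrite {2}/dist; case: pselect => [ex|nex].
  case: ex_minnP => p _ pmin; apply/agreeP/h => k kp.
  by apply/eqP/negPn/negP => /pmin; rewrite leqNgt kp.
have -> : a = b.
  apply: agree_eq => n; apply: h => k _.
  by apply/eqP/negPn/negP => ack; apply: nex; exists k.
rewrite /dist; case: pselect => // h0; exfalso.
by case: h0 => k; rewrite eqxx.
Qed.

(** Two words in distinct cylinders compare as any other two words of these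
    cylinders: a cylinder is an interval. *)
Lemma cyl_transfer le N a a' b b' : cylinder_order le ->
  agree N a a' -> agree N b b' -> ~ agree N a b -> le a b -> le a' b'.
Proof.
move=> lC aa bb ab lab.
have lab' : le a b'.
  case/orP: (cyl_total lC a b') => // ba; case: ab.
  have := cyl_agree lC ba lab (agree_sym bb).
  by move=> b'a; apply: agree_sym; apply: agree_trans bb b'a.
case/orP: (cyl_total lC a' b') => // ba; case: ab.
exact: agree_trans (cyl_agree lC lab' ba aa) (agree_sym bb).
Qed.

Definition shift_max le a := forall k, le (shift k a) a.

Lemma shift_shift p q a : shift p (shift q a) = shift (q + p) a.
Proof. by apply: funext => i; rewrite /shift addnA. Qed.

Lemma sup_suffixes_max le a : cylinder_order le -> shift_max le (sup_suffixes le a).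
Proof.
move=> lC k; set x := sup_suffixes le a.
have [ub _] := sup_suffixesP a lC.
case/orP: (cyl_total lC (shift k x) x) => // xs.
suff -> : shift k x = x by apply: cyl_refl lC _.
apply: agree_eq => n.
have [i xi] := sup_suffixes_agree a (k + n) lC.
have si : agree n (shift (i + k) a) (shift k x).
  move=> t tn; have := xi (k + t); rewrite ltn_add2l => /(_ tn) {}xi.
  by rewrite -shift_shift; apply: esym.
have ix : le (shift (i + k) a) x by apply: ub; exists (i + k).
exact: agree_trans (agree_sym si) (cyl_agree lC ix xs si).
Qed.

(** Passing to the supremum of the suffixes is idempotent, so that the spectrum
    is the set of fixed points of [sup_suffixes]. *)
Lemma sup_wordsP le a : cylinder_order le -> sup_words le a <-> shift_max le a.
Proof.
move=> lC; split=> [[b _ <-]|amax]; first exact: sup_suffixes_max.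
exists a => //; have [ub lub] := sup_suffixesP a lC.
apply: (cyl_anti lC); apply/andP; split.
  by apply: lub => _ [k _ <-]; apply: amax.
by apply: ub; exists 0.
Qed.

Lemma sup_words_accP le x : cylinder_order le ->
  accumulation_point (sup_words le) x <->
  forall n, exists y, [/\ shift_max le y, y <> x & agree n x y].
Proof.
move=> lC; split=> [/accumulation_pointP acc n|acc].
  by have [y [/(sup_wordsP _ lC) My yx xy]] := acc n; exists y.
apply/accumulation_pointP => n; have [y [My yx xy]] := acc n.
by exists y; split=> //; apply/(sup_wordsP _ lC).
Qed.

End CylinderOrders.

Section Pullback.
Variables (A B : finType) (le : rel (nat -> A)) (f : (nat -> B) -> nat -> A).
Hypothesis lC : cylinder_order le.
Hypothesis f_cyl : forall a n, exists N, n <= N /\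
  forall b, agree n a b <-> agree N (f a) (f b).

Definition pullback : rel (nat -> B) := fun a b => le (f a) (f b).

Lemma cyl_map_inj : injective f.
Proof.
move=> a b e; apply: agree_eq => n; have [N [_ h]] := f_cyl a n.
by apply/h; rewrite e.
Qed.

Lemma pullback_cyl : cylinder_order pullback.
Proof.
rewrite /pullback; split.
- by move=> a; apply: cyl_refl lC _.
- by move=> a b /(cyl_anti lC) /cyl_map_inj.
- by move=> a b c; apply: cyl_trans lC _ _ _.
- by move=> a b; apply: cyl_total lC _ _.
move=> a b c ab bc; apply: agree_dist => n.
have [N [_ h]] := f_cyl a n => /h ac; apply/h.
exact: cyl_agree lC ab bc ac.
Qed.

(** If [f] carries maximal words to maximal words, then the smallest
    accumulation point of the pulled back order gives an upper bound for [m];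
    when all maximal words close to [m] are images by [f], nothing below that
    bound is missed. *)
Lemma pullback_smallest m : 1 < #|B| ->
  (forall a, shift_max pullback a <-> shift_max le (f a)) ->
  (forall x, (forall N, exists a, agree N x (f a)) -> exists a, x = f a) ->
  (forall a x, accumulation_point (sup_words le) x -> le x (f a) ->
     exists N, forall y, shift_max le y -> agree N x y -> exists b, y = f b) ->
  smallest_accumulation_point le m ->
  exists m', smallest_accumulation_point pullback m' /\ m = f m'.
Proof.
move=> B2 fmax fclosed fcapt [macc mmin].
have [m' [acc' min']] := smallest_accumulation_point_exists B2 pullback_cyl.
have mfm' : le m (f m').
  apply/mmin/(sup_words_accP _ lC) => n.
  have [N [nN h]] := f_cyl m' n.
  have [y [/fmax My ym my]] := (sup_words_accP _ pullback_cyl).1 acc' n.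
  exists (f y); split=> //; first by move/cyl_map_inj.
  by apply: agree_le nN _; apply/h.
have [N0 capt] := fcapt _ _ macc mfm'.
have near n : exists b, [/\ shift_max pullback b, f b <> m & agree n m (f b)].
  have [y [My ym my]] := (sup_words_accP _ lC).1 macc (maxn n N0).
  have [|b yb] := capt y My; first by apply: agree_le my; apply: leq_maxr.
  exists b; rewrite -yb; split=> //; first by apply/fmax; rewrite -yb.
  by apply: agree_le my; apply: leq_maxl.
have [a ma] : exists a, m = f a.
  by apply: fclosed => n; have [b [_ _ h]] := near n; exists b.
have aacc : accumulation_point (sup_words pullback) a.
  apply/(sup_words_accP _ pullback_cyl) => n; have [N [_ h]] := f_cyl a n.
  have [b [Mb bm mb]] := near N; exists b; split=> //.
    by move=> ba; apply: bm; rewrite ba.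
  by apply/h; rewrite -ma.
exists m'; split=> //; apply: (cyl_anti lC); rewrite mfm' ma /=.
exact: min'.
Qed.

End Pullback.

(** * The substitutions 0 -> 10^j, 1 -> 10^k *)

Section Prepend.

Implicit Types (s t : seq bool) (a b : nat -> bool).

Definition prepend s a : nat -> bool := fun i => nth (a (i - size s)) s i.

Lemma prepend_lt s a i : i < size s -> prepend s a i = nth false s i.
Proof. exact: set_nth_default. Qed.

Lemma prepend_nil a : prepend [::] a = a.
Proof. by apply: funext => t; rewrite /prepend nth_nil subn0. Qed.

Lemma prepend_ge s a i : prepend s a (size s + i) = a i.
Proof. by rewrite /prepend nth_default ?leq_addr // addKn. Qed.

Lemma prepend_cat s t a : prepend (s ++ t) a = prepend s (prepend t a).
Proof.
apply: funext => i; rewrite /prepend nth_cat size_cat subnDA.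
by case: ltnP => h; [apply: set_nth_default | rewrite [RHS]nth_default].
Qed.

Lemma shift_prepend s a i : shift (size s + i) (prepend s a) = shift i a.
Proof. by apply: funext => t; rewrite /shift -addnA prepend_ge. Qed.

Lemma shift_prepend_le s a i : i <= size s ->
  shift i (prepend s a) = prepend (drop i s) a.
Proof.
move=> si; rewrite -{1}(cat_take_drop i s) prepend_cat.
have {1}-> : i = size (take i s) + 0 by rewrite size_takel ?addn0.
by rewrite shift_prepend; apply: funext => t.
Qed.

Lemma mkseq_prepend s a n :
  mkseq (prepend s a) (size s + n) = s ++ mkseq a n.
Proof.
apply: (@eq_from_nth _ false); first by rewrite size_cat !size_mkseq.
move=> i; rewrite size_mkseq => isn; rewrite nth_mkseq // nth_cat.
case: ltnP => si; first exact: prepend_lt.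
by rewrite -{1}(subnKC si) prepend_ge nth_mkseq //; lia.
Qed.

Lemma mkseqD_shift a m n : mkseq a (m + n) = mkseq a m ++ @mkseq bool (shift m a) n.
Proof.
rewrite /mkseq iotaD map_cat add0n; congr (_ ++ _).
by rewrite -{1}(addn0 m) iotaDl -map_comp.
Qed.

Lemma prepend_mkseq a n : prepend (mkseq a n) (shift n a) = a.
Proof.
apply: funext => i; case: (ltnP i n) => h.
  by rewrite prepend_lt ?size_mkseq // nth_mkseq.
rewrite /prepend nth_default size_mkseq // /shift; congr a; lia.
Qed.

Lemma agree_mkseq n a b : agree n a b <-> mkseq a n = mkseq b n.
Proof.
split=> [ab|e k kn].
  by apply/eq_in_map => i; rewrite mem_iota => /andP[_]; apply: ab.
by rewrite -(nth_mkseq false a kn) e nth_mkseq.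
Qed.

Lemma agree_prepend s n a b :
  agree (size s + n) (prepend s a) (prepend s b) <-> agree n a b.
Proof.
by rewrite !agree_mkseq !mkseq_prepend; split=> [/eqP|->//];
  rewrite eqseq_cat // eqxx => /eqP.
Qed.

End Prepend.

Section Substitution.
Variables (j k : nat).
Hypothesis jk : j < k.
Implicit Types (a b : nat -> bool) (v w : seq bool).

Definition block (x : bool) : seq bool := true :: nseq (if x then k else j) false.

Definition subst v : seq bool := flatten (map block v).

Lemma subst_cat v w : subst (v ++ w) = subst v ++ subst w.
Proof. by rewrite /subst map_cat flatten_cat. Qed.

Lemma subst1 x : subst [:: x] = block x.
Proof. exact: cats0. Qed.

Lemma size_subst v : size v <= size (subst v).
Proof.
by elim: v => //= x v IH; rewrite /subst /= size_cat ltnS (leq_trans IH) ?leq_addl.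
Qed.

(** Blocks being nonempty, the first [i.+1] of them determine the letter [i]. *)
Definition inf_subst a : nat -> bool :=
  fun i => nth false (subst (mkseq a i.+1)) i.

Lemma nth_subst_mkseq a n i : i < n ->
  nth false (subst (mkseq a n)) i = inf_subst a i.
Proof.
move=> /subnKC <-; rewrite mkseqD_shift subst_cat nth_cat ifT //.
by apply: leq_trans (size_subst _); rewrite size_mkseq.
Qed.

Lemma inf_subst_prefix a n :
  inf_subst a = prepend (subst (mkseq a n)) (inf_subst (shift n a)).
Proof.
apply: funext => i; set s := subst _.
rewrite -(@nth_subst_mkseq a (n + i.+1)) ?leq_addl //.
rewrite mkseqD_shift subst_cat nth_cat -/s /prepend.
case: ltnP => h; first exact: set_nth_default.
by rewrite nth_subst_mkseq ?ltnS ?leq_subr // [RHS]nth_default.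
Qed.

Lemma inf_subst_unfold a :
  inf_subst a = prepend (block (a 0)) (inf_subst (shift 1 a)).
Proof. by rewrite {1}(inf_subst_prefix a 1) subst1. Qed.

Lemma inf_subst0 a : inf_subst a 0.
Proof. by rewrite inf_subst_unfold. Qed.

(** The two blocks share exactly the prefix [10^j]. *)
Lemma inf_subst_head a :
  exists2 b, inf_subst a = prepend (true :: nseq j false) b & b 0 = ~~ a 0.
Proof.
rewrite inf_subst_unfold /block; case: (a 0) => /=; last first.
  by exists (inf_subst (shift 1 a)); rewrite ?inf_subst0.
exists (prepend (nseq (k - j) false) (inf_subst (shift 1 a))).
  by rewrite -prepend_cat cat_cons -nseqD subnKC // ltnW.
by rewrite prepend_lt ?nth_nseq ?size_nseq ?subn_gt0 // if_same.
Qed.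

Lemma inf_subst_first_diff a b n : agree n a b ->
  let s := subst (mkseq a n) ++ true :: nseq j false in
  [/\ mkseq (inf_subst a) (size s) = s, agree (size s) (inf_subst a) (inf_subst b),
      inf_subst a (size s) = ~~ a n & inf_subst b (size s) = ~~ b n].
Proof.
move=> ab s.
have split c : agree n a c ->
    exists2 d, inf_subst c = prepend s d & d 0 = ~~ c n.
  move=> /agree_mkseq ac; have [d e d0] := inf_subst_head (shift n c).
  exists d; last by rewrite d0 /shift addn0.
  by rewrite (inf_subst_prefix c n) -ac e -prepend_cat.
have [d -> d0] := split a (@agree_refl _ n a).
have [d' -> d'0] := split b ab.
have end_s c : prepend s c (size s) = c 0 by rewrite -{1}(addn0 (size s)) prepend_ge.
split; [| |by rewrite end_s|by rewrite end_s].
  by rewrite -{1}(addn0 (size s)) mkseq_prepend cats0.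
by rewrite -(addn0 (size s)); apply/agree_prepend.
Qed.

(** Cylinders correspond to cylinders: since every block starts with 1, the
    image of a prefix followed by the next 1 determines this prefix. This is
    what makes the pulled back order a cylinder order. *)
Lemma inf_subst_cyl a n : exists N, n <= N /\
  forall b, agree n a b <-> agree N (inf_subst a) (inf_subst b).
Proof.
exists (size (subst (mkseq a n)) + 1); split.
  by apply: leq_trans (leq_addr _ _); rewrite -{1}(size_mkseq a n) size_subst.
move=> b; split=> [ab|sab].
  rewrite (inf_subst_prefix a n) (inf_subst_prefix b n).
  move/agree_mkseq: (ab) => ->; apply/agree_prepend => -[|//] _.
  by rewrite !inf_subst0.
apply: contrapT => nab.
have [r [abr dr]] : exists r, agree r a b /\ a r != b r.
  by apply: first_diff => e; apply: nab; rewrite e.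
have rn : r < n.
  by rewrite ltnNge; apply/negP => nr; apply: nab; apply: agree_le nr abr.
have [_ _ ha hb] := inf_subst_first_diff abr.
move/eqP: dr; apply; apply: negb_inj; rewrite -ha -hb; apply: sab.
have -> : n = r + (1 + (n - r.+1)) by lia.
rewrite addn1 ltnS !mkseqD_shift !subst_cat size_cat [leqRHS]size_cat leq_add2l.
rewrite [leqRHS]size_cat subst1 /= !size_nseq; case: (shift r a 0); lia.
Qed.

(** An arbitrary position lies within some block, of which [s] zeros remain.
    More than [j] remaining zeros belong to a block [10^k]. *)
Lemma inf_subst_shift a i : exists n s,
  shift i (inf_subst a) = prepend (nseq s false) (inf_subst (shift n a)) /\
  (s <= j \/ [/\ 0 < n, a n.-1 & s <= k]).
Proof.
elim/ltn_ind: i a => i IH a; case: i IH => [|i] IH.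
  by exists 0, 0; split; [rewrite prepend_nil | left].
rewrite inf_subst_unfold; set B := block (a 0).
case: (leqP i.+1 (size B)) => h.
  exists 1, (size B - i.+1); split.
    rewrite shift_prepend_le //; congr prepend.
    by rewrite /B /= drop_nseq size_nseq subSS.
  by rewrite /B /= size_nseq; case e: (a 0); [right; split=> //; lia|left; lia].
have [n [s [e d]]] := IH (i.+1 - size B) ltac:(rewrite /B /=; lia) (shift 1 a).
exists n.+1, s; split.
  by rewrite -{1}(subnKC (ltnW h)) shift_prepend e shift_shift add1n.
case: d => [|[n0 an sk]]; [by left|right; split=> //].
by rewrite /shift add1n prednK // in an.
Qed.

(** A representative [10^i10^oo] of the words that start with [10^i1]; the
    latter condition reads [agree i.+2 (run i)]. *)
Definition run i : nat -> bool := fun t => (t == 0) || (t == i.+1).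

(** Sequences of blocks [10^j] and [10^k], described without reference to a
    preimage. *)
Definition decodable b := b 0 /\ forall p, b p ->
  agree j.+2 (run j) (shift p b) \/ agree k.+2 (run k) (shift p b).

Definition first_letter b := ~~ b j.+1.
Definition next_block b := shift (size (block (first_letter b))) b.
Definition decode b : nat -> bool := fun n => first_letter (iter n next_block b).

Lemma decodable_unfold b : decodable b ->
  b = prepend (block (first_letter b)) (next_block b) /\ decodable (next_block b).
Proof.
move=> [b0 bD].
have runs l : agree l.+2 (run l) b -> b l.+1 /\ mkseq b l.+1 = true :: nseq l false.
  move=> r; split; first by rewrite -r // /run eqxx orbT.
  apply: (@eq_from_nth _ false); rewrite ?size_mkseq /= ?size_nseq // => i il.
  rewrite nth_mkseq // -r ?(ltn_trans il) // /run (ltn_eqF il) orbF.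
  by case: i il => //= i il; rewrite nth_nseq if_same.
have [e b1] : mkseq b (size (block (first_letter b))) = block (first_letter b)
    /\ b (size (block (first_letter b))).
  rewrite /block /first_letter; case: (bD 0 b0) => r.
    by have [t e] := runs j r; rewrite t /= size_nseq.
  have -> : b j.+1 = false.
    have := r j.+1; rewrite /run /shift add0n => <- //; last lia.
    by rewrite eqSS (ltn_eqF jk).
  by have [e t] := runs k r; rewrite /= size_nseq.
split; first by rewrite -{1}(prepend_mkseq b (size (block (first_letter b)))) e.
split; first by rewrite /next_block /shift addn0.
by move=> p bp; rewrite shift_shift; apply: bD.
Qed.

Lemma decodableP b : decodable b -> b = inf_subst (decode b).
Proof.
move=> bD; apply: agree_eq => n; elim: n b bD => // n IH b bD.
have [e /IH nD] := decodable_unfold bD.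
have dn : shift 1 (decode b) = decode (next_block b).
  by apply: funext => t; rewrite /shift /decode add1n iterSr.
rewrite inf_subst_unfold dn [in agree _ _]e => i; rewrite ltnS => iN.
rewrite /decode /=; case: (ltnP i (size (block (first_letter b)))) => h.
  by rewrite !prepend_lt.
rewrite -(subnKC h) !prepend_ge; apply: nD.
by move: h; rewrite /=; lia.
Qed.

Lemma inf_subst_run a :
  let i := if a 0 then k else j in agree i.+2 (run i) (inf_subst a).
Proof.
rewrite inf_subst_unfold /block; set l := if _ then _ else _ => i il.
rewrite /run; case: i il => // i; rewrite !ltnS leq_eqVlt => /orP[/eqP ->|il] /=.
  have -> : l.+1 = size (true :: nseq l false) + 0 by rewrite /= size_nseq addn0.
  by rewrite prepend_ge inf_subst0 eqxx.
rewrite prepend_lt /= ?size_nseq // nth_nseq if_same.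
by rewrite eqSS (ltn_eqF il).
Qed.

Lemma inf_subst_decodable a : decodable (inf_subst a).
Proof.
split=> [|p]; first exact: inf_subst0.
have [n [s [e _]]] := inf_subst_shift a p.
have -> : inf_subst a p = shift p (inf_subst a) 0 by rewrite /shift addn0.
rewrite e; case: s e => [|s] e.
  by rewrite prepend_nil => _; have := @inf_subst_run (shift n a); case: ifP => _; [right|left].
by rewrite prepend_lt.
Qed.

(** Being decodable is a condition on bounded windows, hence closed. *)
Lemma inf_subst_closed b : (forall N, exists a, agree N b (inf_subst a)) ->
  exists a, b = inf_subst a.
Proof.
move=> lim; exists (decode b); apply: decodableP; split=> [|p bp].
  by have [a ->//] := lim 1; apply: inf_subst0.
have [a ba] := lim (p + k.+2).
have [_ aD] := inf_subst_decodable a.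
have sh : agree k.+2 (shift p (inf_subst a)) (shift p b).
  by move=> t tk; rewrite /shift ba // ltn_add2l.
have ap : inf_subst a p by rewrite -ba //; lia.
case: (aD p ap) => r; [left|right]; apply: agree_trans r _ => //.
by apply: agree_le sh; lia.
Qed.

End Substitution.

(** * Renormalization *)

(** The normalization that survives pulling back by a substitution. *)
Definition zero_below_one (le : rel (nat -> bool)) :=
  forall a b : nat -> bool, ~~ a 0 -> b 0 -> le a b.

Section Renormalization.
Variable le : rel (nat -> bool).
Hypothesis lC : cylinder_order le.
Implicit Types a b c x y : nat -> bool.

Hypothesis le01 : zero_below_one le.

Definition one_zeros : nat -> bool := fun t => t == 0.

Lemma run_one_zeros i l : i < l -> agree i.+2 one_zeros (run l).
Proof. by move=> il t tl; rewrite /one_zeros /run (@ltn_eqF t l.+1) ?orbF //; lia. Qed.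

Lemma run_cases b : b 0 -> (exists i, agree i.+2 (run i) b) \/ b = one_zeros.
Proof.
move=> b0; have [->|ne] := pselect (b = one_zeros); first by right.
have [|[|i] [ag]] := @first_diff _ one_zeros b; first by move=> e; apply: ne.
  by rewrite b0.
rewrite /one_zeros /= => bi; left; exists i => t.
rewrite ltnS leq_eqVlt => /orP[/eqP ->|ti]; first by rewrite /run eqxx orbT; case: (b _) bi.
by rewrite /run (ltn_eqF ti) orbF; apply: ag.
Qed.

(** Whether the words starting with [10^i1] are below those starting with
    [10^(i+1)]. *)
Definition low i := le (run i) one_zeros.

Lemma low_cmp i b c : agree i.+2 (run i) b -> agree i.+2 one_zeros c ->
  if low i then le b c else le c b.
Proof.
move=> rb oc.
have ne : ~ agree i.+2 (run i) one_zeros.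
  by move/(_ i.+1 (ltnSn _)); rewrite /run eqxx orbT.
case: ifP => h; first exact: cyl_transfer lC rb oc ne h.
apply: cyl_transfer lC oc rb _ _; first by move/agree_sym.
by case/orP: (cyl_total lC one_zeros (run i)) => //; rewrite -/(low i) h.
Qed.

(** A low length gives smaller words than all larger lengths, any other length
    gives greater ones. Hence, if [P] contains only low lengths, and all low
    lengths below its elements, then words starting with a length in [P] are
    smaller than all other words starting with 1. *)
Lemma low_segment (P : nat -> Prop) l a b :
  (forall i, P i -> low i) -> (forall i i', P i -> i' < i -> low i' -> P i') ->
  P l -> agree l.+2 (run l) a -> b 0 -> le b a ->
  exists2 i, P i & agree i.+2 (run i) b.
Proof.
move=> Plow Pseg Pl ra b0 lba.
have below c : le a c -> c = b -> a = b.
  by move=> ac cb; apply: (cyl_anti lC); rewrite -{1}cb ac lba.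
have runa : a = b -> exists2 i, P i & agree i.+2 (run i) b.
  by move=> <-; exists l.
case: (run_cases b0) => [[i rb]|bo]; last first.
  apply/runa/(below b) => //; rewrite bo.
  by have := low_cmp ra (@agree_refl _ _ one_zeros); rewrite Plow.
have [Pi|nPi] := pselect (P i); first by exists i.
apply/runa/(below b) => //; case: (ltngtP i l) => il.
- have := low_cmp rb (agree_trans (run_one_zeros il) (agree_le (ltnW il : i.+2 <= l.+2) ra)).
  by case: ifP => // h; case: nPi; apply: Pseg Pl il h.
- have := low_cmp ra (agree_trans (run_one_zeros il) (agree_le (ltnW il : l.+2 <= i.+2) rb)).
  by rewrite Plow.
by case: nPi; rewrite il.
Qed.

Lemma shift_max_runs (P : nat -> Prop) l a p :
  (forall i, P i -> low i) -> (forall i i', P i -> i' < i -> low i' -> P i') ->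
  P l -> shift_max le a -> agree l.+2 (run l) a -> a p ->
  exists2 i, P i & agree i.+2 (run i) (shift p a).
Proof.
move=> Plow Pseg Pl Ma ra ap; apply: low_segment Plow Pseg Pl ra _ (Ma p).
by rewrite /shift addn0.
Qed.

Lemma shift_max_zero a : shift_max le a -> ~~ a 0 -> forall t, ~~ a t.
Proof.
move=> Ma a0 t; apply/negP => at1.
have e : a = shift t a.
  by apply: (cyl_anti lC); rewrite Ma le01 //= /shift addn0.
by move: a0; rewrite e /shift addn0 at1.
Qed.

(** The only maximal word starting with 0 is [0^oo]. *)
Lemma acc_starts_with_one x : accumulation_point (sup_words le) x -> x 0.
Proof.
move=> /(sup_words_accP _ lC) acc; apply/negPn/negP => x0.
have [y [My yx xy]] := acc 1; apply: yx; apply: funext => t.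
have yz : forall t, ~~ y t by apply: shift_max_zero; rewrite -?xy.
have [z [Mz _ xz]] := acc t.+1.
rewrite xz // (negbTE (yz t)); apply/esym/negbTE.
by apply: shift_max_zero => //; rewrite -xz.
Qed.

Definition periodic i : nat -> bool := fun t => t %% i.+1 == 0.

Lemma periodic_max i : shift_max le (periodic i).
Proof.
move=> p; case: (boolP (p %% i.+1 == 0)) => h.
  have -> : shift p (periodic i) = periodic i; last exact: cyl_refl lC _.
  by apply: funext => t; rewrite /shift /periodic -modnDml (eqP h).
by apply: le01; rewrite /shift /periodic ?addn0 ?mod0n.
Qed.

(** The periodic words [(10^n)^oo] are maximal and converge to [10^oo]. *)
Lemma one_zeros_acc : accumulation_point (sup_words le) one_zeros.
Proof.
apply/(sup_words_accP _ lC) => n; exists (periodic n); split.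
- exact: periodic_max.
- by move/(congr1 (fun a => a n.+1)); rewrite /periodic modnn.
by move=> t tn; rewrite /periodic modn_small // ltnW.
Qed.

Lemma all_runs_periodic i y : y 0 ->
  (forall p, y p -> agree i.+2 (run i) (shift p y)) -> y = periodic i.
Proof.
move=> y0 yr; have ym n : y (n * i.+1).
  elim: n => // n /yr /(_ i.+1 (ltnSn _)).
  by rewrite /run eqxx orbT /shift mulSnr => <-.
apply: funext => t; rewrite {1}(divn_eq t i.+1) /periodic.
have /(_ (t %% i.+1)) := yr _ (ym (t %/ i.+1)).
have h := @ltn_pmod t i.+1 isT; rewrite /shift => <-; last exact: ltnW.
by rewrite /run (ltn_eqF h) orbF.
Qed.

(** Below [10^oo], maximal words have all runs equal to the low length, which
    leaves a single periodic word. *)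
Lemma smallest_one_low m : smallest_accumulation_point le m ->
  (forall i i', low i -> low i' -> i = i') -> m = one_zeros.
Proof.
move=> [macc mmin] low1.
have mo : le m one_zeros by apply: mmin; apply: one_zeros_acc.
case: (run_cases (acc_starts_with_one macc)) => // -[l rm].
case: (boolP (low l)) => hl; last first.
  apply: (cyl_anti lC); rewrite mo.
  by have := low_cmp rm (@agree_refl _ _ one_zeros); rewrite (negbTE hl).
have near n : exists y, [/\ y <> m, agree n m y & y = periodic l].
  have [y [My ym my]] := (sup_words_accP _ lC).1 macc (maxn n l.+2).
  have ry : agree l.+2 (run l) y.
    by apply: agree_trans rm _; apply: agree_le my; apply: leq_maxr.
  exists y; split=> //; first by apply: agree_le my; apply: leq_maxl.
  apply: all_runs_periodic; first by rewrite -ry.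
  move=> p yp; have [//|//|i hi] := @shift_max_runs (fun i => low i) l y p _ _ hl My ry yp.
  by rewrite (low1 l i).
have [y [ym _ yp]] := near 0; case: ym.
rewrite yp; apply: agree_eq => n.
by have [z [_ mz zp]] := near n; apply: agree_sym; rewrite -zp.
Qed.

Section TwoLow.
Variables j k : nat.
Hypotheses (jk : j < k) (lj : low j) (lk : low k).
Hypothesis jk_min : forall i, i < k -> low i -> i = j.

Let P i := i = j \/ i = k.

Lemma two_low_segment :
  (forall i, P i -> low i) /\ (forall i i', P i -> i' < i -> low i' -> P i').
Proof.
split=> [i [->|->] //|i i' [->|->] ii li]; left; apply: jk_min => //.
exact: ltn_trans jk.
Qed.

Lemma pullback_zero_below_one : zero_below_one (pullback le (inf_subst j k)).
Proof.
move=> a b /negbTE a0 b0; have := @inf_subst_run j k a; have := @inf_subst_run j k b.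
rewrite a0 b0 /pullback => rb ra.
have := low_cmp ra (agree_trans (run_one_zeros jk) (agree_le (ltnW jk : j.+2 <= k.+2) rb)).
by rewrite lj.
Qed.

Lemma inf_subst_max a :
  shift_max (pullback le (inf_subst j k)) a <-> shift_max le (inf_subst j k a).
Proof.
split=> Ma p.
  have [n [[|s] [-> _]]] := inf_subst_shift jk a p; last first.
    by apply: le01; [rewrite prepend_lt | apply: inf_subst0].
  by rewrite prepend_nil; apply: Ma.
rewrite /pullback; set s := subst j k (mkseq a p).
suff -> : inf_subst j k (shift p a) = shift (size s) (inf_subst j k a) by [].
rewrite (inf_subst_prefix j k a p) -/s -{1}(addn0 (size s)) shift_prepend.
by apply: funext => t.
Qed.

Lemma smallest_two_low m : smallest_accumulation_point le m ->
  exists m', smallest_accumulation_point (pullback le (inf_subst j k)) m' /\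
    m = inf_subst j k m'.
Proof.
have [Plow Pseg] := two_low_segment.
move=> sm; apply: (pullback_smallest lC (inf_subst_cyl jk) _ _ _ _ sm) => {m sm}.
- by rewrite card_bool.
- exact: inf_subst_max.
- exact: inf_subst_closed.
move=> a x xacc xa.
have [l Pl rl] : exists2 l, P l & agree l.+2 (run l) (inf_subst j k a).
  by exists (if a 0 then k else j); [case: (a 0); [right|left] | apply: inf_subst_run].
have [i Pi ri] := low_segment Plow Pseg Pl rl (acc_starts_with_one xacc) xa.
exists i.+2 => y My xy; exists (decode j k y); apply: decodableP => //.
have ry := agree_trans ri xy.
split; first by rewrite -ry.
move=> p yp; have [i' [] -> r] := shift_max_runs Plow Pseg Pi My ry yp.
  by left.
by right.
Qed.

End TwoLow.

Lemma renormalize m : smallest_accumulation_point le m ->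
  m = one_zeros \/ exists j k m', [/\ j < k, cylinder_order (pullback le (inf_subst j k)),
    zero_below_one (pullback le (inf_subst j k)),
    smallest_accumulation_point (pullback le (inf_subst j k)) m' &
    m = inf_subst j k m'].
Proof.
move=> sm; have [[i [i' [ii li li']]]|N] :=
    pselect (exists i i', [/\ i < i', low i & low i']); last first.
  left; apply: smallest_one_low => // i i' li li'.
  by case: (ltngtP i i') => // h; case: N; [exists i, i'|exists i', i].
have ex1 : exists i, low i by exists i.
case: (ex_minnP ex1) => j lj jmin.
have ex2 : exists i, (j < i) && low i.
  by exists i'; rewrite li' (leq_ltn_trans (jmin _ li)).
case: (ex_minnP ex2) => k /andP[jk lk] kmin.
have jk_min i0 : i0 < k -> low i0 -> i0 = j.
  move=> ik l0; apply/eqP; rewrite eqn_leq jmin // andbT leqNgt; apply/negP => ji.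
  by have := kmin i0; rewrite ji l0 leqNgt ik => /(_ isT).
have [m' [sm' e]] := smallest_two_low jk lj lk jk_min sm.
right; exists j, k, m'; split=> //.
  exact: pullback_cyl lC (inf_subst_cyl jk).
exact: pullback_zero_below_one.
Qed.

End Renormalization.

(** * Right special words *)

(** Every factor of a one-sided word extends to the right, so the growth of the
    factor complexity is governed by the words with two such extensions. *)
Definition right_special (a : nat -> bool) (w : seq bool) :=
  exists i0 i1, [/\ w = mkseq (shift i0 a) (size w), ~~ a (i0 + size w),
    w = mkseq (shift i1 a) (size w) & a (i1 + size w)].

Lemma one_zeros_special w : right_special one_zeros w -> w = [::].
Proof.
by case=> i0 [i1 [_ _ _]]; rewrite /one_zeros addn_eq0 => /andP[_ /nilP].
Qed.

(** Surrounds [subst j k v] by what is common to the images of all left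
    extensions, respectively right extensions, of [v]. *)
Definition extend j k (v : seq bool) :=
  nseq j false ++ subst j k v ++ true :: nseq j false.

Section SpecialSubst.
Variables j k : nat.
Hypothesis jk : j < k.

(** In both occurrences, the decoding of a right special word with a letter 1
    starts at its first letter 1, and it ends where the decoded words differ.
    Zeros in excess of [j] on the left reveal that the preceding block is
    [10^k]. *)
Lemma special_subst (a : nat -> bool) w : right_special (inf_subst j k a) w ->
  (exists2 l, l < k & w = nseq l false) \/
  exists v, [/\ right_special a v, size v < size w & suffix w (extend j k v)].
Proof.
set x := inf_subst j k a; set n := size w => -[i0 [i1 [w0 x0 w1 x1]]].
have [n0 [s0 [e0 d0]]] := inf_subst_shift jk a i0.
have [n1 [s1 [e1 d1]]] := inf_subst_shift jk a i1.
rewrite -/x in e0 e1.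
set c0 := shift n0 a in e0; set c1 := shift n1 a in e1.
have {}x0 : ~~ prepend (nseq s0 false) (inf_subst j k c0) n by rewrite -e0.
have {}x1 : prepend (nseq s1 false) (inf_subst j k c1) n by rewrite -e1.
rewrite e0 -/n in w0; rewrite e1 -/n in w1.
have ag : agree n (prepend (nseq s0 false) (inf_subst j k c0))
                  (prepend (nseq s1 false) (inf_subst j k c1)).
  by apply/agree_mkseq; rewrite -w0.
have zeros s (c : nat -> bool) t : t < s -> prepend (nseq s false) c t = false.
  by move=> ts; rewrite prepend_lt ?size_nseq // nth_nseq ts.
have end0 s c t : prepend (nseq s false) c (s + t) = c t :> bool.
  by rewrite -{2}(size_nseq s false) prepend_ge.
have one s c : prepend (nseq s false) (inf_subst j k c) s.
  by rewrite -{2}(addn0 s) end0 inf_subst0.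
have s0k : s0 <= k by case: d0 => [|[]] //; lia.
case: (ltnP n s0) => ns0.
  left; exists n; first exact: leq_trans s0k.
  apply: (@eq_from_nth _ false); rewrite ?size_nseq // -/n => i il.
  by rewrite nth_nseq il w0 nth_mkseq // zeros // (ltn_trans il).
(* From here on, [w] contains a letter 1, and the first one is at [s0 = s1]. *)
have {}ns0 : s0 < n.
  by rewrite ltn_neqAle ns0 andbT; apply/eqP => h; rewrite -h one in x0.
have s10 : s1 = s0.
  case: (ltngtP s1 s0) => // h.
    by have := ag s1 (ltn_trans h ns0); rewrite zeros // one.
  by have := ag s0 ns0; rewrite [RHS]zeros // one.
move: d1 e1 x1 w1 ag; rewrite {s1}s10 => d1 e1 x1 w1 ag.
set s := s0 in d0 d1 e0 e1 x0 x1 w0 w1 ag ns0 s0k *.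
pose q := n - s; have nq : n = s + q by rewrite /q subnKC // ltnW.
rewrite nq !end0 in x0 x1.
rewrite nq in ag.
have {}ag : agree q (inf_subst j k c0) (inf_subst j k c1).
  by move=> t tq; have := ag (s + t); rewrite !end0; apply; rewrite ltn_add2l.
have [r [cr dr]] : exists r, agree r c0 c1 /\ c0 r != c1 r.
  by apply: first_diff => e; rewrite -e (negbTE x0) in x1.
pose v := @mkseq bool c0 r; have sv : size v = r by rewrite size_mkseq.
have [vS vag v0 v1] := inf_subst_first_diff jk cr.
set S := _ ++ _ in vS vag v0 v1.
have qS : q = size S.
  apply: (first_diff_uniq ag _ vag).
    by rewrite x1; case: (inf_subst _ _ _ _) x0.
  by rewrite v0 v1; apply: contra dr => /eqP /negb_inj ->.
have c0r : c0 r by move: x0; rewrite qS v0 negbK.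
have c1r : c1 r = false by move: x1; rewrite qS v1 => /negbTE.
have wE : w = nseq s false ++ S.
  by rewrite w0 nq -{2}(size_nseq s false) mkseq_prepend qS vS.
have sS : size v + j.+1 <= size S.
  by rewrite /S size_cat /= size_nseq leq_add2r -/v size_subst.
(* With at most [j] zeros on the left, [v] suffices; otherwise both occurrences
   of [v] are preceded by the letter 1. *)
right; case: (leqP s j) => sj.
  exists v; split.
  - exists n1, n0; rewrite sv -/c0 -/c1; split=> //.
    + exact/agree_mkseq.
    + by move: c1r; rewrite /c1 /shift => ->.
  - by rewrite -/n nq qS; lia.
  apply/suffixP; exists (nseq (j - s) false).
  by rewrite wE catA -nseqD subnK.
case: d0 => [|[n0p an0 _]]; first by rewrite leqNgt sj.
case: d1 => [|[n1p an1 _]]; first by rewrite leqNgt sj.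
have pred_v m : 0 < m -> a m.-1 -> mkseq (shift m.-1 a) r.+1 = true :: mkseq (shift m a) r.
  move=> mp am; rewrite -(add1n r) mkseqD_shift shift_shift addn1 prednK //=.
  by rewrite /mkseq /= /shift addn0 am.
exists (true :: v); split.
- exists n1.-1, n0.-1; rewrite /= sv !pred_v // -/c0 -/c1; split=> //.
  + by congr (_ :: _); apply/agree_mkseq.
  + have -> : n1.-1 + r.+1 = n1 + r by lia.
    by move: c1r; rewrite /c1 /shift => ->.
  + by have -> : n0.-1 + r.+1 = n0 + r by lia.
- by rewrite -/n nq qS /=; lia.
apply/suffixP; exists (nseq j false ++ true :: nseq (k - s) false).
rewrite wE /extend -cat1s subst_cat subst1 /block /S -/v -!catA; congr (_ ++ _).
by rewrite !cat_cons (catA (nseq (k - s) false)) -nseqD subnK.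
Qed.

Lemma extend_count_mono x y :
  (forall b, count_mem b x <= count_mem b y) ->
  forall b, count_mem b (extend j k x) <= count_mem b (extend j k y).
Proof.
have cnt b z : count_mem b (subst j k z) =
    count_mem true z * count_mem b (block j k true) +
    count_mem false z * count_mem b (block j k false).
  elim: z => [|c z IH]; first by rewrite /subst /= !mul0n.
  by rewrite -cat1s subst_cat count_cat IH subst1 !count_cat !mulnDl; case: c => /=; lia.
move=> xy b; rewrite /extend !count_cat !cnt leq_add2l leq_add2r.
by apply: leq_add; apply: leq_mul.
Qed.

Lemma nseq_suffix_subst z : suffix (nseq j false) (nseq j false ++ subst j k z).
Proof.
elim/last_ind: z => [|z c _]; first by rewrite cats0 suffix_refl.
rewrite -cats1 subst_cat subst1 catA /block -cat1s catA.
apply: suffix_catr; apply/suffixP.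
exists (nseq ((if c then k else j) - j) false); rewrite -nseqD subnK //.
by case: c => //; apply: ltnW.
Qed.

Lemma extend_suffix x y : suffix x y -> suffix (extend j k x) (extend j k y).
Proof.
case/suffixP=> z ->; have /suffixP[t e] := nseq_suffix_subst z.
by apply/suffixP; exists t; rewrite /extend subst_cat !catA -e.
Qed.

End SpecialSubst.

(** * At most three right special words of each length *)

(** A superset of the right special words of a word directed by the
    substitutions with parameters in [p]. The empty list describes [10^oo],
    whose only right special word is empty. *)
Fixpoint special_tree (p : seq (nat * nat)) (w : seq bool) : Prop :=
  if p is (j, k) :: p' then
    (exists2 l, l < k & w = nseq l false) \/
    (exists2 v, special_tree p' v & suffix w (extend j k v))
  else w = [::].

(** What the composition of the extensions at the levels already passed
    preserves. Comparing letter counts, rather than lengths, is what composes. *)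
Definition growing (F : seq bool -> seq bool) :=
  (forall x y, suffix x y -> suffix (F x) (F y)) /\
  (forall x y, (forall b, count_mem b x <= count_mem b y) ->
     forall b, count_mem b (F x) <= count_mem b (F y)).

Lemma growing_comp F j k : j < k -> growing F -> growing (F \o extend j k).
Proof.
move=> jk [Fs Fc]; split=> x y h; first by apply/Fs/extend_suffix.
by apply/Fc/extend_count_mono.
Qed.

Lemma growing_size F x y : growing F ->
  (forall b, count_mem b x <= count_mem b y) -> size (F x) <= size (F y).
Proof.
move=> [_ Fc] /Fc h.
have cnt (z : seq bool) : size z = count_mem true z + count_mem false z.
  by elim: z => //= -[] z ->; lia.
by rewrite !cnt leq_add.
Qed.

Lemma suffix_eq_drop (T : eqType) (x y z : seq T) :
  suffix x z -> suffix y z -> size x <= size y -> x = drop (size y - size x) y.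
Proof.
rewrite suffixE => /eqP xz /suffixP[t e] xy.
rewrite -{1}xz e size_cat -addnBA // drop_cat ifF; last by apply/negbTE; lia.
by rewrite addKn.
Qed.

Definition tail n (z : seq bool) := drop (size z - n) z.

Lemma suffix_tail n w z : suffix w z -> size w = n -> w = tail n z.
Proof. by rewrite suffixE /tail => /eqP wz <-. Qed.

Lemma suffix_tail_trans n w y z : suffix w z -> size w = n -> suffix y z -> n <= size y ->
  w = tail n y.
Proof.
by move=> wz wn yz ny; rewrite /tail -wn; apply: suffix_eq_drop wz yz _; rewrite wn.
Qed.

Lemma suffix_nseq l l' (b : bool) : l <= l' -> suffix (nseq l b) (nseq l' b).
Proof. by move=> ll; apply/suffixP; exists (nseq (l' - l) b); rewrite -nseqD subnK. Qed.

Definition wf_params (p : seq (nat * nat)) := all (fun jk => jk.1 < jk.2) p.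

(** The words of length [n] are on the stem of the tree or on the side
    branch [F (0^l)], [l < k], of some level. Of the side branches, only
    those of the first level reaching length [n] and of the next one matter:
    two levels further, the stem contains [F (0^k ...)] and so has outgrown the
    side branch. *)
Lemma special_tree_le3 p F n : wf_params p -> growing F ->
  exists x y z, forall v w, special_tree p v -> suffix w (F v) -> size w = n ->
    w \in [:: x; y; z].
Proof.
elim: p F => [|[j k] p IH] F.
  move=> _ _; exists (tail n (F [::])), [::], [::] => v w -> wF wn.
  by rewrite inE -(suffix_tail wF wn) eqxx.
move=> /= /andP[/= jk wfp] gF; have gG := growing_comp jk gF.
set G := F \o extend j k in gG.
have [Fs _] := gF.
have zero_branch H k' l w : growing H -> l < k' -> suffix w (H (nseq l false)) ->
    size w = n -> w = tail n (H (nseq k'.-1 false)).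
  move=> [Hs _] lk wH wn; apply: suffix_tail => //.
  by apply: suffix_trans wH _; apply/Hs/suffix_nseq; case: k' lk.
case: (ltnP (size (F (nseq k.-1 false))) n) => hn.
  have [x [y [z h]]] := IH G wfp gG; exists x, y, z.
  move=> v w [[l lk ->]|[u pu vu]] wF wn; last first.
    by apply: h pu _ wn; apply: suffix_trans wF _; apply: Fs.
  have := size_suffix (suffix_trans wF (Fs _ _ (@suffix_nseq l k.-1 false ltac:(lia)))).
  by rewrite wn leqNgt hn.
exists (tail n (F (nseq k.-1 false))); case: p wfp {IH} => [|[j' k'] p] wfp.
  exists (tail n (G [::])), [::] => v w [[l lk ->]|[u -> vu]] wF wn.
    by rewrite inE -(zero_branch F k l w gF lk wF wn) eqxx.
  have wG : suffix w (G [::]) by apply: suffix_trans wF _; apply: Fs.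
  by rewrite !inE -(suffix_tail wG wn) eqxx orbT.
move: wfp => /= /andP[/= jk' wfp].
(* The common end of the third and all further levels, seen from the first:
   [0^k] is the end of the last block [10^k]. *)
pose y := nseq k false ++ subst j k (nseq j' false) ++ true :: nseq j false.
exists (tail n (G (nseq k'.-1 false))), (tail n (F y)).
move=> v w [[l lk ->]|[u [[l lk' eu]|[u' pu uu']] vu]] wF wn.
- by rewrite inE -(zero_branch F k l w gF lk wF wn) eqxx.
- have wG : suffix w (G (nseq l false)).
    by apply: suffix_trans wF _; apply: Fs; rewrite -eu.
  by rewrite !inE -(zero_branch G k' l w gG lk' wG wn) eqxx orbT.
suff -> : w = tail n (F y) by rewrite !inE eqxx !orbT.
have wG : suffix w (G (extend j' k' u')).
  apply: suffix_trans wF _; apply: suffix_trans (Fs _ _ vu) _.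
  exact: (proj1 gG).
apply: suffix_tail_trans wG wn _ _.
  apply: Fs; apply/suffixP.
  exists (nseq j false ++ subst j k (nseq j' false ++ subst j' k' u') ++ [:: true]).
  rewrite {1}/extend {1}/extend /y -(cat1s true (nseq j' false)).
  by rewrite !subst_cat subst1 /block -!catA.

apply: leq_trans hn _; apply: growing_size => // b.
rewrite /y count_cat; apply: leq_trans (leq_addr _ _).
by rewrite !count_nseq leq_mul // leq_pred.
Qed.

(** Only the lengths up to [N] are described, so finitely many renormalizations
    suffice. *)
Lemma special_words_tree N (le : rel (nat -> bool)) m : cylinder_order le ->
  zero_below_one le -> smallest_accumulation_point le m ->
  exists2 p, wf_params p & forall w, size w <= N -> right_special m w -> special_tree p w.
Proof.
elim: N le m => [|N IH] le m lC le01 sm.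
  by exists [::] => // w; rewrite leqn0 => /nilP.
have [->|[j [k [m' [jk lC' le01' sm' ->]]]]] := renormalize lC le01 sm.
  by exists [::] => // w _ /one_zeros_special.
have [p wfp ptree] := IH _ _ lC' le01' sm'.
exists ((j, k) :: p) => [|w wN]; first by rewrite /= jk.
case/(special_subst jk) => [|[v [rv vw wv]]]; [by left|right].
by exists v => //; apply: ptree => //; rewrite -ltnS (leq_trans vw).
Qed.

Lemma special_words_le3 n (le : rel (nat -> bool)) m : cylinder_order le ->
  zero_below_one le -> smallest_accumulation_point le m ->
  exists x y z, forall w, right_special m w -> size w = n -> w \in [:: x; y; z].
Proof.
move=> lC le01 sm; have [p wfp ptree] := special_words_tree n lC le01 sm.
have [//|x [y [z h]]] := @special_tree_le3 p id n wfp; exists x, y, z => w rw wn.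
by apply: (h w w) => //; [apply: ptree; rewrite ?wn | apply: suffix_refl].
Qed.

(** * Reduction to two letters *)

Section TwoLetters.
Variables (A : finType) (le : rel (nat -> A)).
Hypothesis lC : cylinder_order le.
Implicit Types x y : nat -> A.

Definition letter_le : rel A := fun u v => le (fun=> u) (fun=> v).

Lemma letter_le_word (a b : nat -> A) : a 0 != b 0 -> letter_le (a 0) (b 0) -> le a b.
Proof.
have ag (c : nat -> A) : agree 1 (fun=> c 0) c by move=> t; rewrite ltnS leqn0 => /eqP ->.
move=> ab; apply: (cyl_transfer lC (ag a) (ag b)) => /(_ 0 isT)/eqP.
by rewrite (negbTE ab).
Qed.

(** Sorting the alphabet by constant words exhibits its two smallest letters. *)
Lemma two_smallest_letters : 1 < #|A| -> exists u v,
  [/\ u != v, letter_le u v & forall w, [\/ w = u, w = v | letter_le v w]].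
Proof.
move=> A2.
have tot : total letter_le by move=> u v; apply: cyl_total lC _ _.
have tr : transitive letter_le by move=> u v w; apply: cyl_trans lC _ _ _.
have := mem_enum A; have := enum_uniq A; have := sort_sorted tot (enum A).
have : 1 < size (sort letter_le (enum A)) by rewrite size_sort -cardE.
rewrite -(sort_uniq letter_le).
move=> sz so un mem; have {}mem w : w \in sort letter_le (enum A).
  by rewrite mem_sort mem.
case: (sort _ _) sz so un mem => [|u [|v s]] // _ so un mem.
move: so un => /= /andP[uv pv] /andP[+ _].
rewrite inE negb_or => /andP[uv' _]; exists u, v; split=> // w.
have := mem w; rewrite !inE => /or3P[/eqP|/eqP|ws]; [by constructor 1| |].
  by constructor 2.
by constructor 3; apply: (allP (order_path_min tr pv)).
Qed.

(** Any accumulation point over the two smallest letters bounds [m] from above,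
    and a maximal word starting with one of these letters has no other
    letters. *)
Lemma binary_reduction m : 1 < #|A| -> smallest_accumulation_point le m ->
  exists (le' : rel (nat -> bool)) m' (c : bool -> A),
    [/\ cylinder_order le', zero_below_one le',
        smallest_accumulation_point le' m' & m = c \o m'].
Proof.
move=> A2 sm; have [u [v [uv luv uvmin]]] := two_smallest_letters A2.
pose c z := if z then v else u; pose f (a : nat -> bool) : nat -> A := c \o a.
have cinj : injective c by rewrite /c => -[] [] // e; move: uv; rewrite e eqxx.
have f_cyl (a : nat -> bool) n : exists N,
    n <= N /\ forall b : nat -> bool, agree n a b <-> agree N (f a) (f b).
  exists n; split=> // b; split=> ab t tn; first by rewrite /f /= ab.
  by apply: cinj; apply: ab.
have codomP x : (forall t, x t = u \/ x t = v) -> exists a, x = f a.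
  move=> xuv; exists (fun t => x t == v); apply: funext => t; rewrite /f /c /=.
  by case: (xuv t) => ->; rewrite ?eqxx // (negbTE uv).
have low (b d : nat -> A) : le b d -> d 0 = u \/ d 0 = v -> b 0 = u \/ b 0 = v.
  move=> bd d0; case: (uvmin (b 0)) => [?|?|vb]; [by left|by right|].
  case: (eqVneq (d 0) (b 0)) => [<- //|db].
  suff e : d = b by move: db; rewrite e eqxx.
  apply: (cyl_anti lC); rewrite bd andbT; apply: letter_le_word => //.
  by case: d0 => -> //; apply: (cyl_trans lC) luv vb.
have fuv (a : nat -> bool) : f a 0 = u \/ f a 0 = v by rewrite /f /c /=; case: (a 0); [right|left].
have [||||m' [sm' mm']] := pullback_smallest lC f_cyl _ _ _ _ sm.
- by rewrite card_bool.
- by move=> a; split=> h t; apply: h.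
- move=> x lim; apply: codomP => t; have [a xa] := lim t.+1.
  by rewrite xa // /f /c /=; case: (a t); [right|left].
- move=> a x _ xa; exists 1 => y My xy; apply: codomP => t.
  have := low _ _ (My t); rewrite /shift addn0; apply.
  by rewrite -xy //; apply: low xa _.
exists (pullback le f), m', c; split=> //; first exact: pullback_cyl lC f_cyl.
move=> a b /negbTE a0 b0; apply: letter_le_word; by rewrite /f /c /= a0 b0.
Qed.

End TwoLetters.

(** * Factor complexity *)

Definition factors (A : finType) (a : nat -> A) n : {set n.-tuple A} :=
  [set w : n.-tuple A | `[< exists k, tval w = mkseq (shift k a) n >]].

Lemma factor_complexityE (A : finType) (a : nat -> A) n :
  factor_complexity a n = #|factors a n|.
Proof.
apply: eq_card => w; rewrite !inE; apply: asbool_equiv_eq.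
have e k : tval [tuple a (k + i) | i < n] = mkseq (shift k a) n.
  by rewrite /mkseq -val_enum_ord -map_comp.
by split=> -[k h]; exists k; [rewrite h e|apply: val_inj; rewrite /= h -e].
Qed.

Lemma factor_complexity_map (A B : finType) (c : B -> A) (a : nat -> B) n :
  factor_complexity (c \o a) n <= factor_complexity a n.
Proof.
rewrite !factor_complexityE.
apply: leq_trans (leq_imset_card (map_tuple c) (factors a n)).
apply/subset_leq_card/subsetP => w; rewrite inE => /asboolP[k wk].
apply/imsetP; exists [tuple of mkseq (shift k a) n].
  by rewrite inE; apply/asboolP; exists k.
by apply: val_inj; rewrite /= wk /mkseq -map_comp.
Qed.

(** Grouping the factors of length [n.+1] by their last letter, a factor of
    length [n] is counted twice exactly when it is right special. *)
Lemma factor_complexity_succ (a : nat -> bool) n r :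
  (exists2 s, size s <= r & forall w, right_special a w -> size w = n -> w \in s) ->
  factor_complexity a n.+1 <= factor_complexity a n + r.
Proof.
move=> [s sr special]; rewrite !factor_complexityE.
pose ext (x : bool) (w : n.-tuple bool) := [tuple of rcons w x].
pose P x := [set w | ext x w \in factors a n.+1].
have PE x (w : n.-tuple bool) : w \in P x ->
    exists2 k, tval w = mkseq (shift k a) n & x = a (k + n).
  rewrite !inE => /asboolP[k /=]; rewrite mkseqS => /rcons_inj[ew ex].
  by exists k.
have /subset_leq_card/leq_trans : factors a n.+1 \subset
    (ext true @: P true) :|: (ext false @: P false).
  apply/subsetP => w; rewrite inE => /asboolP[k]; rewrite mkseqS => wk.
  pose v := [tuple of mkseq (shift k a) n].
  have wv : w = ext (shift k a n) v by apply: val_inj.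
  have vP : v \in P (shift k a n).
    by rewrite inE -wv inE; apply/asboolP; exists k; rewrite mkseqS.
  by rewrite inE wv; case: (shift k a n) vP => vP; rewrite imset_f ?orbT.
apply; apply: leq_trans (leq_card_setU _ _) _.
apply: leq_trans (leq_add (leq_imset_card _ _) (leq_imset_card _ _)) _.
rewrite -cardsUI; apply: leq_add.
  apply/subset_leq_card/subsetP => w; rewrite inE => /orP[]/PE[k wk _].
    by rewrite inE; apply/asboolP; exists k.
  by rewrite inE; apply/asboolP; exists k.
apply: leq_trans sr; rewrite cardE -(size_map val).
apply: uniq_leq_size => [|_ /mapP[w wP ->]].
  by rewrite map_inj_uniq ?enum_uniq //; apply: val_inj.
move: wP; rewrite mem_enum inE => /andP[/PE[k1 e1 l1] /PE[k0 e0 l0]].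
apply: special; last exact: size_tuple.
by exists k0, k1; rewrite size_tuple -l0 -l1.
Qed.

Theorem proposition6 (A : finType) (le : rel (nat -> A)) (m : nat -> A) (n : nat) :
  (1 < #|A|)%N -> cylinder_order le -> smallest_accumulation_point le m ->
  (2 <= n)%N -> (factor_complexity m n <= 3 * n - 2)%N.
Proof.
move=> A2 lC sm n2.
have [le' [m' [c [lC' le01 sm' ->]]]] := binary_reduction lC A2 sm.
apply: leq_trans (factor_complexity_map c m' n) _.
elim: n n2 => // n IH; rewrite leq_eqVlt => /orP[/eqP <-|n2].
  apply: leq_trans (max_card _) _.
  by rewrite card_tuple card_bool.
have [x [y [z h]]] := special_words_le3 n lC' le01 sm'.
have := @factor_complexity_succ m' n 3; have := IH n2.
move=> h1 h2; have {}h2 := h2 (ex_intro2 _ _ [:: x; y; z] isT h); lia.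
Qed.
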